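(* Let $(A_k)_{k=1}^\infty$ be a sequence of matrices in $\mathbb{C}^{d\times d}$ and $S\in\mathbb{C}^{d\times d}$. If $\sum_{k=1}^\infty A_k=S$ in the conventional sense, then $\sum_{k=1}^\infty A_k$ is Lambert summable to $S$.
   Context: A series of matrices equals $S$ in the conventional sense (is conventionally summable to $S$) if its partial sums converge to $S$ in any matrix norm. The series $\sum_{k=1}^\infty A_k$ is Lambert summable to $S$ if $\sum_{k=1}^\infty\frac{kx^k}{1+x+\dots+x^{k-1}}A_k$ is conventionally summable for every $x\in(0,1)$ and $$\lim_{x\to1^-}(1-x)\sum_{k=1}^\infty\frac{kx^k}{1-x^k}A_k=S.$$ *)

(* Defs.v *)
From mathcomp Require Import all_boot all_order all_algebra.
From mathcomp Require Import all_classical all_reals all_analysis.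
From mathcomp Require Import complex.

Set Implicit Arguments.
Unset Strict Implicit.
Unset Printing Implicit Defensive.

Import Order.TTheory GRing.Theory Num.Theory.
Import numFieldNormedType.Exports.
Local Open Scope classical_set_scope.
Local Open Scope ring_scope.
Local Open Scope complex_scope.

(* MathComp-Analysis attaches the topology of a field to the structure
   [numClosedFieldType], not to the bare type [R[i]]. *)
Definition cplx (R : realType) : numClosedFieldType := R[i].

Definition matrix_norm (R : realType) (d : nat) (N : 'M[cplx R]_d -> R) : Prop :=
  [/\ forall A, N A = 0 -> A = 0,
      forall A B, N (A + B) <= N A + N B &
      forall (c : cplx R) A, N (c *: A) = complex.Re `|c| * N A].

(* The library topology on matrices is that of the entrywise maximum norm;
   convergence for it is convergence in every matrix norm. *)
Lemma cvg_matrix_normP (R : realType) (d : nat) (u : nat -> 'M[cplx R]_d)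
    (S : 'M[cplx R]_d) :
  u @ \oo --> S <->
  forall N, matrix_norm N -> N (u n - S) @[n --> \oo] --> (0 : R).
Proof.
have Re_normK (V : normedZmodType (cplx R)) (A : V) :
    (complex.Re `|A|)%:C = `|A| :> cplx R.
  by apply: (@RRe_real R); apply: normr_real.
have entry_le (A : 'M[cplx R]_d) i j : `|A i j| <= `|A|.
  rewrite [leRHS]mx_normE -[leLHS]nngE num_le.
  exact: (le_bigmax _ (fun ij : 'I_d * 'I_d => `|A ij.1 ij.2|%:nng) (i, j)).
split=> [uS N [N0 ND NZ]|uN].
  have Nz : N 0 = 0 by rewrite -(scale0r 0) NZ normr0 mul0r.
  have NN A : N (- A) = N A by rewrite -scaleN1r NZ normrN normr1 mul1r.
  have Nge0 A : 0 <= N A.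
    by rewrite -(pmulrn_lge0 _ (ltn0Sn 1)) mulr2n -[X in _ + X]NN -Nz -(subrr A) ND.
  pose C := \sum_(i < d) (\sum_(j < d) N (delta_mx i j)) : R.
  have Cge0 : 0 <= C by do 2![apply: sumr_ge0 => ? _].
  have Nsum (I : finType) (F : I -> 'M[cplx R]_d) : N (\sum_(i : I) F i) <= \sum_(i : I) N (F i).
    elim/big_ind2 : _ => [|x a y b xa yb|//]; first by rewrite Nz.
    exact: le_trans (ND _ _) (lerD xa yb).
  have Nle A : N A <= complex.Re `|A| * C.
    rewrite {1}[A]matrix_sum_delta mulr_sumr.
    apply: le_trans (Nsum _ _) _; apply: ler_sum => i _.
    rewrite mulr_sumr; apply: le_trans (Nsum _ _) _; apply: ler_sum => j _.
    rewrite NZ ler_wpM2r //.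
    by rewrite -(@lecR R) !Re_normK.
  apply/cvgrPdist_lt => e e0.
  have eC : 0 < (e / (C + 1))%:C :> cplx R.
    by rewrite (@ltcR R) divr_gt0 // ltr_wpDl.
  move/cvgrPdist_lt : uS => /(_ _ eC); apply: filterS => n.
  rewrite -Re_normK (@ltcR R) ltr_pdivlMr ?ltr_wpDl // => h.
  rewrite sub0r normrN ger0_norm // -NN opprB.
  apply: le_lt_trans (Nle _) (le_lt_trans _ h).
  rewrite ler_wpM2l ?lerDl ?ler01 //.
  by rewrite -(@lecR R) Re_normK normr_ge0.
have /uN uN1 : matrix_norm (fun A : 'M[cplx R]_d => complex.Re `|A|).
  split=> [A A0|A B|c A].
  - by apply/eqP; rewrite -normr_eq0 -Re_normK A0.
  - by rewrite -(@lecR R) rmorphD /= !Re_normK ler_normD.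
  - by apply: (@complexI R); rewrite rmorphM /= !Re_normK normrZ.
apply/cvgrPdist_lt => e e0.
have eE : (complex.Re e)%:C = e :> cplx R by apply: (@RRe_real R); apply: gtr0_real.
have e0' : 0 < complex.Re e by rewrite -(@ltcR R) eE.
move/cvgrPdist_lt : uN1 => /(_ _ e0'); apply: filterS => n.
rewrite sub0r normrN distrC => h.
rewrite -eE -Re_normK (@ltcR R); apply: le_lt_trans h.
exact: ler_norm.
Qed.

(* Series run from k = 1; the value [A 0] is never used. *)
Definition conv_summable_to (R : realType) (d : nat) (A : nat -> 'M[cplx R]_d)
    (S : 'M[cplx R]_d) : Prop :=
  (\sum_(1 <= k < n) A k) @[n --> \oo] --> S.

Definition conv_summable (R : realType) (d : nat)
    (A : nat -> 'M[cplx R]_d) : Prop :=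
  exists S, conv_summable_to A S.

(* For 0 < x < 1 the series under [limn] has the terms of the first condition
   divided by [1 - x], so that condition guarantees its convergence. *)
Definition Lambert_summable_to (R : realType) (d : nat)
    (A : nat -> 'M[cplx R]_d) (S : 'M[cplx R]_d) : Prop :=
  (forall x : R, 0 < x < 1 ->
     conv_summable (fun k : nat =>
       (k%:R * x ^+ k / (\sum_(0 <= j < k) x ^+ j))%:C *: A k)) /\
  ((1 - x)%:C *:
    limn (fun n : nat =>
      \sum_(1 <= k < n) ((k%:R * x ^+ k / (1 - x ^+ k))%:C *: A k)))
    @[x --> (1 : R)^'-] --> S.

(* Main.v *)
Require Import Defs.
From mathcomp Require Import all_boot all_order all_algebra.
From mathcomp Require Import all_classical all_reals all_analysis.
From mathcomp Require Import complex.
From mathcomp Require Import ring lra.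

Set Implicit Arguments.
Unset Strict Implicit.
Unset Printing Implicit Defensive.

Import Order.TTheory GRing.Theory Num.Theory.
Import numFieldNormedType.Exports.
Local Open Scope classical_set_scope.
Local Open Scope ring_scope.
Local Open Scope complex_scope.

(** For [0 < x < 1] put [w x k = k x^k / (1 + x + ... + x^(k-1))], which is also
    [(1 - x) k x^k / (1 - x^k)].  Both clauses of Lambert summability are
    statements about the weighted series with terms [w x k *: A k]: the first
    says that it converges, the second that its sum tends to [S] as
    [x --> 1^-].  This is Abel's uniform convergence test.

    The inverse [1 / w x k] is the arithmetic mean of [x^-1, ..., x^-k], an
    increasing sequence, so [w x k] decreases in [k >= 1]; moreover
    [0 <= w x k <= 1], and [w x k --> 1] as [x --> 1^-] because the mean of [k]
    ones is [1].  Partial summation ([abel_inequality]) then bounds every block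
    [\sum_(N <= k < n) w x k * a k] by the largest block sum of the unweighted
    series starting at [N], whatever [x] is.  Hence the partial sums of the
    weighted series are Cauchy uniformly in [x], and the limits in [n] and in
    [x] may be exchanged ([abel_uniform_limit]).

    The argument takes place over the complete ordered field [R].  It reaches
    complex matrices because a matrix is a combination, with finitely many real
    coordinates, of the fixed matrices [E_ij] and ['i E_ij] ([mx_ReIm_sum]):
    the convergence of [\sum A k] passes to the coordinates
    ([cvg_mx_coord]), and the conclusion passes back
    ([abel_uniform_limit_coords]). *)

(** * Abel's test with uniformity in a parameter *)

(** Partial summation writes the weighted sum as a combination of the block
    sums with the nonnegative coefficients [w k - w k.+1] and [w n], and these
    telescope to [w N]. *)
Lemma abel_inequality (R : realType) (w a : nat -> R) (e : R) (N n : nat) :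
  (N <= n)%N -> (forall k, (N <= k)%N -> 0 <= w k.+1 <= w k) ->
  (forall m, (N <= m)%N -> `|\sum_(N <= k < m) a k| <= e) ->
  `|\sum_(N <= k < n) w k * a k| <= e * w N.
Proof.
move=> leNn w_anti a_le.
have w_ge0 k : (N <= k)%N -> 0 <= w k.
  by move=> /w_anti/andP[wk1 wk]; exact: le_trans wk.
pose B m := \sum_(N <= k < m) a k.
(* Removing the boundary term [w m * B m] leaves the part of the partial
   summation formula whose coefficients telescope to [w N - w m]. *)
have parts m : (N <= m)%N ->
    `|\sum_(N <= k < m) w k * a k - w m * B m| <= e * (w N - w m).
  elim: m => [|m IH].
    by rewrite leqn0 => /eqP ->; rewrite /B !big_geq// mulr0 !subrr normr0 mulr0.
  rewrite leq_eqVlt => /predU1P[<-|].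
    by rewrite /B !big_geq// mulr0 !subrr normr0 mulr0.
  rewrite ltnS => leNm.
  have -> : \sum_(N <= k < m.+1) w k * a k - w m.+1 * B m.+1 =
      (\sum_(N <= k < m) w k * a k - w m * B m) + (w m - w m.+1) * B m.+1.
    by rewrite /B !big_nat_recr//=; ring.
  apply: le_trans (ler_normD _ _) _.
  have -> : e * (w N - w m.+1) = e * (w N - w m) + (w m - w m.+1) * e by ring.
  rewrite lerD ?IH// normrM ger0_norm ?subr_ge0; last by case/andP: (w_anti _ leNm).
  rewrite ler_wpM2l ?subr_ge0 ?a_le//; first by case/andP: (w_anti _ leNm).
  exact: leqW.
rewrite -(subrK (w n * B n) (\sum_(_ <= _ < _) _)).
apply: le_trans (ler_normD _ _) _.
rewrite -[leRHS](subrK (w n * e)) lerD//.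
  by rewrite [w n * e]mulrC -mulrBr parts.
by rewrite normrM ger0_norm ?w_ge0// ler_wpM2l ?w_ge0// a_le.
Qed.

(** The Cauchy estimate for the tails of [\sum a k] serves for all weights
    [w t] at once, so it gives both the convergence for each [t] and the
    exchange of the limits in [n] and along [F].  The weights are constrained
    from index 1 on, where the series start: Lambert weights vanish at 0. *)
Lemma abel_uniform_limit (R : realType) (T : Type) (F : set_system T)
    (FF : ProperFilter F) (D : set T) (w : T -> nat -> R) (a : nat -> R) (s : R) :
  F D ->
  (forall t k, D t -> (0 < k)%N -> 0 <= w t k.+1 <= w t k) ->
  (forall t k, D t -> w t k <= 1) ->
  (forall k, (0 < k)%N -> w t k @[t --> F] --> (1 : R)) ->
  \sum_(1 <= k < n) a k @[n --> \oo] --> s ->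
  exists L : T -> R,
    (forall t, D t -> \sum_(1 <= k < n) w t k * a k @[n --> \oo] --> L t) /\
    L t @[t --> F] --> s.
Proof.
move=> FD w_anti w_le1 w_cvg a_cvg.
pose f t n := \sum_(1 <= k < n) w t k * a k.
have unif e : 0 < e -> exists2 N, (0 < N)%N &
    `|s - \sum_(1 <= k < N) a k| <= e /\
    forall t n, D t -> (N <= n)%N -> `|f t n - f t N| <= e.
  move=> e0; have e20 : 0 < e / 2 by rewrite divr_gt0.
  have /cvgrPdist_le/(_ _ e20)[N _ sN] := a_cvg.
  exists N.+1 => //; split.
    by apply: le_trans (sN _ _) _; rewrite /= ?leqnSn//; lra.
  move=> t n Dt leNn; rewrite /f (@big_cat_nat _ _ _ N.+1)//=.
  rewrite [X in X - _]addrC addrK.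
  apply: (@le_trans _ _ (e * w t N.+1)); last first.
    by rewrite ler_piMr ?w_le1// ltW.
  apply: abel_inequality => // [k Nk|m Nm].
    by apply: w_anti => //; exact: leq_trans Nk.
  have -> : \sum_(N.+1 <= k < m) a k =
      (s - \sum_(1 <= k < N.+1) a k) - (s - \sum_(1 <= k < m) a k).
    by rewrite [X in _ - (_ - X)](@big_cat_nat _ _ _ N.+1)//=; ring.
  apply: le_trans (ler_normB _ _) _.
  rewrite (splitr e) lerD//; apply: sN => //=; exact: ltnW.
have f_cvg t : D t -> cvgn (f t).
  move=> Dt; apply: cauchy_cvg; apply: cauchy_exP => e e0.
  (* A fixed partial sum [f t N] is the centre of a small ball that contains
     all later partial sums. *)
  have [|N N0 [_ fN]] := unif (e / 2); first by rewrite divr_gt0.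
  exists (f t N); exists N => // n /= Nn.
  rewrite -ball_normE /= distrC (le_lt_trans (fN _ _ Dt Nn))//; lra.
exists (fun t => limn (f t)); split=> [t /f_cvg//|].
apply/cvgrPdist_le => e e0.
have e30 : 0 < e / 3 by rewrite divr_gt0.
have [N N0 [sN fN]] := unif _ e30.
have fN_cvg : f t N @[t --> F] --> \sum_(1 <= k < N) a k.
  rewrite /f [X in _ --> X]big_nat.
  under eq_cvg do rewrite big_nat.
  apply: cvg_big => [|k /andP[k0 _]]; first exact: add_continuous.
  by rewrite -[a k in X in _ --> X]mul1r; apply: cvgMl; exact: w_cvg.
have /cvgrPdist_le/(_ _ e30) fNe := fN_cvg.
near=> t.
have Dt : D t by near: t.
have limfN : `|limn (f t) - f t N| <= e / 3.
  have lim_cvg : `|f t n - f t N| @[n --> \oo] --> `|limn (f t) - f t N|.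
    by apply: cvg_norm; apply: cvgB; [exact: f_cvg|exact: cvg_cst].
  rewrite -(cvg_lim _ lim_cvg)//; apply: limr_le.
    by apply/cvg_ex; eexists; exact: lim_cvg.
  by exists N => // n Nn; exact: fN.
have fNt : `|\sum_(1 <= k < N) a k - f t N| <= e / 3 by near: t.
have -> : s - limn (f t) = (s - \sum_(1 <= k < N) a k) +
   (\sum_(1 <= k < N) a k - f t N) - (limn (f t) - f t N) by ring.
apply: le_trans (ler_normB _ _) _.
apply: le_trans (lerD (ler_normD _ _) (lexx _)) _; lra.
Unshelve. all: by end_near. Qed.

(** * From real coordinates to complex matrices *)

Lemma cvg_real_complex (R : realType) (T : Type) (F : set_system T)
    (FF : Filter F) (f : T -> R) (l : R) :
  f t @[t --> F] --> l ->
  ((f t)%:C : cplx R) @[t --> F] --> (l%:C : cplx R).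
Proof.
move=> /cvgrPdist_lt fl; apply/cvgrPdist_lt => e e0.
(* A positive element of the field of complex numbers is real. *)
have eE : (complex.Re e)%:C = e :> cplx R.
  by apply: (@RRe_real R); apply: gtr0_real.
have Re_e0 : 0 < complex.Re e by rewrite -(@ltcR R) eE.
apply: filterS (fl _ Re_e0) => t.
by rewrite -raddfB /= normc_def /= expr0n addr0 sqrtr_sqr -{2}eE (@ltcR R).
Qed.

(** A finite combination of fixed vectors depends continuously on its real
    coefficients, so Abel's test in each coordinate suffices. *)
Lemma abel_uniform_limit_coords (R : realType) (V : normedModType (cplx R))
    (I : finType) (B : I -> V) (T : Type) (F : set_system T)
    (FF : ProperFilter F) (D : set T) (w : T -> nat -> R)
    (a : I -> nat -> R) (s : I -> R) :
  F D ->
  (forall t k, D t -> (0 < k)%N -> 0 <= w t k.+1 <= w t k) ->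
  (forall t k, D t -> w t k <= 1) ->
  (forall k, (0 < k)%N -> w t k @[t --> F] --> (1 : R)) ->
  (forall i, \sum_(1 <= k < n) a i k @[n --> \oo] --> s i) ->
  exists L : T -> V,
    (forall t, D t ->
       \sum_(1 <= k < n) ((w t k)%:C *: \sum_i (a i k)%:C *: B i)
         @[n --> \oo] --> L t) /\
    L t @[t --> F] --> \sum_i (s i)%:C *: B i.
Proof.
move=> FD w_anti w_le1 w_cvg a_cvg.
have comb_cvg (U : Type) (G : set_system U) (FG : Filter G)
    (f : U -> I -> R) (l : I -> R) :
    (forall i, f u i @[u --> G] --> l i) ->
    \sum_i (f u i)%:C *: B i @[u --> G] --> \sum_i (l i)%:C *: B i.
  move=> fl; apply: cvg_big => [|i _]; first exact: add_continuous.
  exact: cvgZr_tmp (cvg_real_complex FG (fl i)).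
have /choice[L L_cvg] i := abel_uniform_limit FF FD w_anti w_le1 w_cvg (a_cvg i).
exists (fun t => \sum_i (L i t)%:C *: B i); split=> [t Dt|]; last first.
  by apply: comb_cvg => i; have [_] := L_cvg i.
have -> : (fun n => \sum_(1 <= k < n) ((w t k)%:C *: \sum_i (a i k)%:C *: B i)) =
    (fun n => \sum_i (\sum_(1 <= k < n) w t k * a i k)%:C *: B i).
  apply/funext => n; under eq_bigr do rewrite scaler_sumr.
  rewrite exchange_big; apply: eq_bigr => i _.
  rewrite rmorph_sum scaler_suml; apply: eq_bigr => k _.
  by rewrite scalerA rmorphM.
by apply: comb_cvg => i; have [/(_ _ Dt)] := L_cvg i.
Qed.

(** The boolean selects between [E_ij] ([true]) and ['i E_ij] ([false]). *)
Definition mx_coord (R : realType) (d : nat) (A : 'M[cplx R]_d)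
    (p : 'I_d * 'I_d * bool) : R :=
  if p.2 then complex.Re (A p.1.1 p.1.2) else complex.Im (A p.1.1 p.1.2).

Definition mx_coord_basis (R : realType) (d : nat)
    (p : 'I_d * 'I_d * bool) : 'M[cplx R]_d :=
  (if p.2 then 1 else 'i : cplx R) *: delta_mx p.1.1 p.1.2.

Lemma mx_ReIm_sum (R : realType) (d : nat) (A : 'M[cplx R]_d) :
  A = \sum_p (mx_coord A p)%:C *: mx_coord_basis R p.
Proof.
rewrite -(pair_bigA _ (fun q b =>
  (mx_coord A (q, b))%:C *: mx_coord_basis R (q, b))) /=.
rewrite [LHS]matrix_sum_delta pair_bigA; apply: eq_bigr => -[i j] _ /=.
rewrite big_bool /mx_coord /mx_coord_basis /= !scalerA -scalerDl mulr1.
by congr (_ *: _); rewrite {1}[A i j]complexE mulrC.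
Qed.

Lemma mx_coordB (R : realType) (d : nat) (p : 'I_d * 'I_d * bool) :
  {morph (fun A : 'M[cplx R]_d => mx_coord A p) : A B / A - B}.
Proof. by move=> A B; rewrite /mx_coord !mxE; case: p.2; rewrite raddfB. Qed.

Lemma mx_coord_sum (R : realType) (d : nat) (p : 'I_d * 'I_d * bool)
    (A : nat -> 'M[cplx R]_d) (m n : nat) :
  mx_coord (\sum_(m <= k < n) A k) p = \sum_(m <= k < n) mx_coord (A k) p.
Proof. by rewrite /mx_coord summxE; case: p.2; rewrite raddf_sum. Qed.

Lemma mx_coord_le_norm (R : realType) (d : nat) (A : 'M[cplx R]_d)
    (p : 'I_d * 'I_d * bool) :
  `|mx_coord A p|%:C <= `|A| :> cplx R.
Proof.
apply: (@le_trans _ _ `|A p.1.1 p.1.2|); last first.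
  rewrite [leRHS]mx_normE -[leLHS]nngE num_le.
  exact: (le_bigmax _ (fun ij : 'I_d * 'I_d => `|A ij.1 ij.2|%:nng) p.1).
rewrite /mx_coord; case: p.2; first exact: normc_ge_Re.
by rewrite normc_def lecR -sqrtr_sqr ler_wsqrtr// lerDr sqr_ge0.
Qed.

Lemma cvg_mx_coord (R : realType) (d : nat) (u : nat -> 'M[cplx R]_d)
    (S : 'M[cplx R]_d) (p : 'I_d * 'I_d * bool) :
  u n @[n --> \oo] --> S -> mx_coord (u n) p @[n --> \oo] --> mx_coord S p.
Proof.
move=> /cvgrPdist_lt uS; apply/cvgrPdist_lt => e e0.
have eC : 0 < e%:C :> cplx R by rewrite (@ltcR R).
apply: filterS (uS _ eC) => n; rewrite -mx_coordB -(@ltcR R).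
exact: le_lt_trans (mx_coord_le_norm _ _).
Qed.

(** * The Lambert weights *)

Definition lambert_weight (R : realType) (x : R) (k : nat) : R :=
  k%:R * x ^+ k / (\sum_(0 <= j < k) x ^+ j).

Lemma geo_sum_gt0 (R : realType) (x : R) (k : nat) :
  0 < x -> (0 < k)%N -> 0 < \sum_(0 <= j < k) x ^+ j.
Proof.
case: k => // k x0 _; rewrite big_nat_recl// expr0 ltr_pwDl//.
by apply: sumr_ge0 => j _; rewrite exprn_ge0// ltW.
Qed.

Lemma lambert_weight_ge0 (R : realType) (x : R) (k : nat) :
  0 < x -> 0 <= lambert_weight x k.
Proof.
move=> x0; have x_ge0 := ltW x0.
rewrite /lambert_weight divr_ge0 ?mulr_ge0 ?exprn_ge0//.
by apply: sumr_ge0 => j _; rewrite exprn_ge0// ltW.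
Qed.

(** Each of the [k] terms [x^j] of the denominator is at least [x^k]. *)
Lemma lambert_weight_le1 (R : realType) (x : R) (k : nat) :
  0 < x < 1 -> lambert_weight x k <= 1.
Proof.
case/andP=> x0 x1; case: k => [|k]; first by rewrite /lambert_weight !mul0r.
rewrite /lambert_weight ler_pdivrMr ?geo_sum_gt0// mul1r mulr_natl.
have -> : x ^+ k.+1 *+ k.+1 = \sum_(0 <= j < k.+1) x ^+ k.+1.
  by rewrite sumr_const_nat subn0.
by apply: ler_sum_nat => j /andP[_ jk];
  rewrite ler_wiXn2l ?(ltW x0) ?(ltW x1) ?(ltnW jk).
Qed.

(** With [g] the denominator at [k], the one at [k.+1] is [1 + x g]; after
    clearing denominators the inequality becomes [x g <= k], true since [x g]
    is the sum of the [k] powers [x, ..., x^k]. *)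
Lemma lambert_weight_anti (R : realType) (x : R) (k : nat) :
  0 < x < 1 -> (0 < k)%N ->
    lambert_weight x k.+1 <= lambert_weight x k.
Proof.
case/andP=> x0 x1 k0; rewrite /lambert_weight.
rewrite ler_pdivrMr ?geo_sum_gt0// mulrAC ler_pdivlMr ?geo_sum_gt0//.
set g := \sum_(0 <= j < k) x ^+ j.
have -> : \sum_(0 <= j < k.+1) x ^+ j = 1 + x * g.
  by rewrite big_nat_recl// expr0 mulr_sumr; under eq_bigr do rewrite exprS.
have xg_le : x * g <= k%:R.
  have -> : k%:R = \sum_(0 <= j < k) (1 : R) by rewrite sumr_const_nat subn0.
  rewrite mulr_sumr; apply: ler_sum => j _.
  by rewrite -exprS exprn_ile1// ltW.
rewrite -natr1 exprS.
have -> : (k%:R + 1) * (x * x ^+ k) * g = x ^+ k * ((k%:R + 1) * (x * g)) by ring.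
rewrite mulrAC [leRHS]mulrC ler_wpM2l ?exprn_ge0 ?(ltW x0)//.
by rewrite mulrDr mulr1 mulrDl mul1r addrC lerD2r.
Qed.

Lemma lambert_weight_cvg1 (R : realType) (k : nat) : (0 < k)%N ->
  lambert_weight x k @[x --> (1 : R)^'-] --> (1 : R).
Proof.
move=> k0; apply: cvg_at_left_filter.
have kE : lambert_weight (1 : R) k = 1.
  rewrite /lambert_weight expr1n mulr1; under eq_bigr do rewrite expr1n.
  by rewrite sumr_const_nat subn0 divff// pnatr_eq0 -lt0n.
rewrite -[X in _ --> X]kE; apply: cvgM.
  by apply: cvgM; [exact: cvg_cst|exact: exprn_continuous].
apply: cvgV; first by rewrite gt_eqF// geo_sum_gt0.
apply: cvg_big => [|j _]; [exact: add_continuous|exact: exprn_continuous].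
Qed.

Lemma lambert_weightE (R : realType) (x : R) (k : nat) :
  k%:R * x ^+ k / (1 - x ^+ k) = (1 - x)^-1 * lambert_weight x k.
Proof.
rewrite -[1 - x ^+ k]opprB subrX1 -mulNr opprB.
by rewrite /lambert_weight big_mkord invfM; ring.
Qed.

Theorem corollary4p9 (R : realType) (d : nat) (A : nat -> 'M[cplx R]_d)
    (S : 'M[cplx R]_d) :
  conv_summable_to A S -> Lambert_summable_to A S.
Proof.
move=> AS.
have coord_cvg p :
    \sum_(1 <= k < n) mx_coord (A k) p @[n --> \oo] --> mx_coord S p.
  by have := cvg_mx_coord (p := p) AS; under eq_cvg do rewrite mx_coord_sum.
have in01 : \forall x \near (1 : R)^'-, 0 < x < 1.
  near=> x; apply/andP; split; near: x;
    [exact: nbhs_left_gt|exact: nbhs_left_lt].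
have [|||L [L_cvg L_lim]] := abel_uniform_limit_coords (@mx_coord_basis R d)
  (at_left_proper_filter 1) (D := [set x | 0 < x < 1])
  (w := @lambert_weight R) (a := fun p k => mx_coord (A k) p) in01 _ _ _ coord_cvg.
- move=> x k x01 k0; rewrite lambert_weight_anti// lambert_weight_ge0//.
  by case/andP: x01.
- by move=> x k; exact: lambert_weight_le1.
- by move=> k; exact: lambert_weight_cvg1.
have {}L_cvg x : 0 < x < 1 ->
    \sum_(1 <= k < n) (lambert_weight x k)%:C *: A k @[n --> \oo] --> L x.
  move=> x01; have := L_cvg x x01.
  by under eq_cvg do under eq_bigr do rewrite -mx_ReIm_sum.
rewrite -mx_ReIm_sum in L_lim.
split=> [x x01|]; first by exists (L x); exact: L_cvg.
apply: cvg_trans L_lim; apply: near_eq_cvg; near=> x.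
have x01 : 0 < x < 1 by near: x.
have x1 : 1 - x != 0 by rewrite subr_eq0 gt_eqF//; case/andP: x01.
have -> : (fun n =>
      \sum_(1 <= k < n) ((k%:R * x ^+ k / (1 - x ^+ k))%:C *: A k)) =
    (fun n =>
      ((1 - x)^-1)%:C *: \sum_(1 <= k < n) (lambert_weight x k)%:C *: A k).
  apply/funext => n; rewrite scaler_sumr; apply: eq_bigr => k _.
  by rewrite lambert_weightE scalerA rmorphM.
rewrite (cvg_lim (@norm_hausdorff _ _) (cvgZl_tmp (L_cvg x x01))).
by rewrite scalerA -rmorphM divff// scale1r.
Unshelve. all: by end_near. Qed.
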